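(* For any prime power $q$, neither $\operatorname{SL}_2(\mathbb{F}_q)$ nor $\operatorname{PSL}_2(\mathbb{F}_q)$ is a characteristic quotient of the free group $F_2$ of rank $2$.
   Context: A group $G$ is a characteristic quotient of $F_2$ if there is a surjective homomorphism $F_2\to G$ whose kernel is a characteristic subgroup of $F_2$ (i.e. stable under all of $\operatorname{Aut}(F_2)$). *)

(* Defs.v *)
From HB Require Import structures.
From mathcomp Require Import all_boot all_order all_algebra all_fingroup all_solvable.

Set Implicit Arguments.
Unset Strict Implicit.
Unset Printing Implicit Defensive.

Import GroupScope.

(* The free group on X, realised as the reduced words over X and its formal
   inverses: the letter (x, true) stands for x and (x, false) for x^-1. *)
Section FreeGroup.
Variable X : choiceType.

Definition letter : choiceType := (X * bool)%type.
Implicit Types (a b : letter) (u v w : seq letter).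

Definition linv a : letter := (a.1, ~~ a.2).

Definition reduced w : bool := sorted (fun a b => b != linv a) w.

Record free_group := FreeGroup { fg_word :> seq letter; _ : reduced fg_word }.

HB.instance Definition _ := [isSub for fg_word].
HB.instance Definition _ := [Choice of free_group by <:].

Definition wcons a w : seq letter :=
  if w is b :: w' then if b == linv a then w' else a :: w else [:: a].

Definition wmul u v : seq letter := foldr wcons v u.
Definition winv u : seq letter := rev (map linv u).

Lemma linvK : involutive linv.
Proof. by case=> x c; rewrite /linv /= negbK. Qed.

Lemma reduced_wcons a w : reduced w -> reduced (wcons a w).
Proof.
case: w => [|b w] //= rw; case: ifP => [_|/negbT ne_ba].
  exact: path_sorted rw.
by rewrite /= ne_ba.
Qed.

Lemma reduced_wmul u v : reduced v -> reduced (wmul u v).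
Proof. by move=> rv; elim: u => //= a u; apply: reduced_wcons. Qed.

Lemma reduced_winv u : reduced u -> reduced (winv u).
Proof.
move=> ru; rewrite /reduced /winv rev_sorted sorted_map.
apply: sub_sorted ru => a b /=; apply: contraNneq => eq_ab.
by rewrite eq_ab linvK.
Qed.

Lemma wconsK a w : reduced w -> wcons (linv a) (wcons a w) = w.
Proof.
case: w => [|b w] /=; first by rewrite linvK eqxx.
have [->|_] := eqVneq b (linv a); last by rewrite /= linvK eqxx.
case: w => [|c w] //= /andP[ne_c _].
by rewrite (negPf ne_c).
Qed.

Lemma wmul_wcons a v w :
  reduced w -> wmul (wcons a v) w = wcons a (wmul v w).
Proof.
move=> rw; case: v => [|b v] //=; case: eqP => [->|_] //=.
by have := wconsK (linv a) (reduced_wmul v rw); rewrite linvK.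
Qed.

Lemma wmulA u v w :
  reduced w -> wmul u (wmul v w) = wmul (wmul u v) w.
Proof. by move=> rw; elim: u => //= a u ->; rewrite wmul_wcons. Qed.

Lemma wmulw1 u : reduced u -> wmul u [::] = u.
Proof.
elim: u => //= a u IHu rau; rewrite IHu; last exact: path_sorted rau.
by case: u rau {IHu} => //= b u /andP[/negPf-> _].
Qed.

Lemma wmulVw u : wmul (winv u) u = [::].
Proof.
rewrite /winv /wmul; elim: u => //= a u IHu.
by rewrite rev_cons -cats1 foldr_cat /= linvK eqxx.
Qed.

Lemma reduced_fg (x : free_group) : reduced x.
Proof. by case: x. Qed.

Definition fg_one : free_group := @FreeGroup [::] isT.
Definition fg_mul (x y : free_group) : free_group :=
  FreeGroup (reduced_wmul x (reduced_fg y)).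
Definition fg_inv (x : free_group) : free_group :=
  FreeGroup (reduced_winv (reduced_fg x)).

Lemma fg_mulA : associative fg_mul.
Proof. by move=> x y z; apply: val_inj; rewrite /= wmulA ?reduced_fg. Qed.

Lemma fg_mul1 : left_id fg_one fg_mul.
Proof. by move=> x; apply: val_inj. Qed.

Lemma fg_mulr1 : right_id fg_one fg_mul.
Proof. by move=> x; apply: val_inj; rewrite /= wmulw1 ?reduced_fg. Qed.

Lemma fg_mulV : left_inverse fg_one fg_inv fg_mul.
Proof. by move=> x; apply: val_inj; rewrite /= wmulVw. Qed.

Lemma fg_mulrV : right_inverse fg_one fg_inv fg_mul.
Proof.
move=> x; rewrite -[LHS]fg_mul1 -{1}(fg_mulV (fg_inv x)) -!fg_mulA.
by rewrite (fg_mulA _ x) fg_mulV fg_mul1 fg_mulV.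
Qed.

HB.instance Definition _ :=
  isGroup.Build free_group fg_mulA fg_mul1 fg_mulr1 fg_mulV fg_mulrV.

Definition fg_gen (x : X) : free_group := @FreeGroup [:: (x, true)] isT.

(* The universal property of the free group. *)
Section Lift.
Variables (H : groupType) (f : X -> H).

Definition leval a : H := if a.2 then f a.1 else (f a.1)^-1.
Definition weval w : H := foldr (fun a h => leval a * h) 1 w.
Definition fg_lift (x : free_group) : H := weval x.

Lemma leval_linv a : leval (linv a) = (leval a)^-1.
Proof. by case: a => x [] //=; rewrite /leval /= invgK. Qed.

Lemma weval_wcons a w : weval (wcons a w) = leval a * weval w.
Proof.
by case: w => [|b w] //=; case: eqP => [->|//]; rewrite leval_linv mulVKg.
Qed.

Lemma weval_wmul u v : weval (wmul u v) = weval u * weval v.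
Proof.
elim: u => [|a u IHu] /=; first by rewrite mul1g.
by rewrite weval_wcons IHu mulgA.
Qed.

Lemma fg_liftM : {morph fg_lift : x y / x * y}.
Proof. by move=> x y; apply: weval_wmul. Qed.

HB.instance Definition _ := isMultiplicative.Build _ _ fg_lift fg_liftM.

Lemma fg_lift_gen x : fg_lift (fg_gen x) = f x.
Proof. exact: mulg1. Qed.

End Lift.

Lemma fg_lift_unique (H : groupType) (g : {multiplicative free_group -> H}) :
  g =1 fg_lift (g \o fg_gen).
Proof.
have g1: g 1 = 1 by apply: (mulgI (g 1)); rewrite -gmulfM !mulg1.
have gV x: g x^-1 = (g x)^-1.
  by apply: (mulgI (g x)); rewrite -gmulfM !mulgV.
have gL a: g (@FreeGroup [:: a] isT) = leval (g \o fg_gen) a.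
  case: a => x [] //; rewrite /leval /= -gV; congr (g _).
  exact: val_inj.
case=> w; elim: w => [|a w IHw] raw; first
  by rewrite -[RHS]g1; congr (g _); apply: val_inj.
have rw: reduced w := path_sorted raw.
have ->: FreeGroup raw = @FreeGroup [:: a] isT * FreeGroup rw.
  apply: val_inj; case: w raw {IHw} rw => //= b w /andP[/negPf ne_b _] _.
  by rewrite ne_b.
by rewrite gmulfM gL IHw fg_liftM [X in _ = X * _]mulg1.
Qed.

End FreeGroup.

(* The letters of F_2 are the two elements of 'I_2. *)
Definition F2 : groupType := free_group 'I_2.

Definition char_subgroup (G : groupType) (K : {pred G}) : Prop :=
  group_closed K /\
  forall phi : {multiplicative G -> G},
    bijective phi -> {in K, forall x, phi x \in K}.

Definition char_quotient_F2 (G : groupType) : Prop :=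
  exists f : {multiplicative F2 -> G},
    (forall g : G, exists x : F2, f x = g) /\
    char_subgroup [pred x : F2 | f x == 1].

Section SpecialLinear2.
Variable F : finFieldType.

Definition SL2_set : {set {'GL_2[F]}} := [set u | (\det (GLval u) == 1)%R].

Lemma SL2_group_set : group_set SL2_set.
Proof.
apply/group_setP; split=> [|u v]; rewrite !inE /=; first by rewrite det1.
by move=> /eqP du /eqP dv; rewrite det_mulmx du dv GRing.mulr1.
Qed.

Definition SL2 : {group {'GL_2[F]}} := Group SL2_group_set.

(* The centre of SL_2(F) is its subgroup of scalar matrices. *)
Definition PSL2 : {group coset_of 'Z(SL2)} := (SL2 / 'Z(SL2))%G.

End SpecialLinear2.

(* Main.v *)
From HB Require Import structures.
Require Import Defs.
From mathcomp Require Import all_boot all_order all_algebra all_fingroup all_solvable.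
From mathcomp Require Import all_field ring.

(* Only orders of elements matter.  Passing to the quotient by the centre, it is
   enough to treat PSL_2.  If a, b generate F_2, every a^k b is the image of a
   under an automorphism, so the images of a and of all a^k b in a
   characteristic quotient have the same order n.  Let A, B in SL_2 lift
   the images of a, b.
   - If n <= 2, the quotient is generated by two involutions whose product is an
     involution, hence is abelian.
   - If n > 2 is prime to the characteristic, let l, 1/l be the eigenvalues of A
     in an algebraic closure; z = l^2 is a primitive n-th root of unity and
     tr(A^k B) = u l^k + v / l^k.  As k ranges over Z/n, each value of
     tr(A^k B)^2 is taken at most twice, while each of these n values has the
     form 2 + w + 1/w with w one of the fewer than n primitive n-th roots of
     unity, w and 1/w being distinct and giving the same value: counting pairs
     (k, w) yields 2n <= 2(n - 1).
   - Otherwise n is the characteristic and A, B, AB, A^2 B are unipotent up to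
     sign; the trace identities then force A and B to commute.
   In each case the quotient would be abelian. *)

Set Implicit Arguments.
Unset Strict Implicit.
Unset Printing Implicit Defensive.

(** * Two by two matrices of determinant one *)

Section TwoByTwo.
Import GRing.Theory.
Local Open Scope ring_scope.

Lemma matrix2P (R : Type) (A B : 'M[R]_2) :
  A 0 0 = B 0 0 -> A 0 1 = B 0 1 -> A 1 0 = B 1 0 -> A 1 1 = B 1 1 -> A = B.
Proof.
have ord2 (i : 'I_2) : i = 0 \/ i = 1.
  by case: i => [[|[]]] // ?; [left | right]; apply: val_inj.
by move=> *; apply/matrixP=> i j; case: (ord2 i) (ord2 j) => [] -> [] ->.
Qed.

Lemma mulmx2E (R : nzRingType) (A B : 'M[R]_2) i j :
  (A * B) i j = A i 0 * B 0 j + A i 1 * B 1 j.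
Proof.
rewrite mxE !big_ord_recl big_ord0 addr0.
by congr (_ + A i _ * B _ j); apply: val_inj.
Qed.

Lemma mxtrace2E (R : nzRingType) (A : 'M[R]_2) : \tr A = A 0 0 + A 1 1.
Proof.
rewrite /mxtrace !big_ord_recl big_ord0 addr0.
by congr (_ + A _ _); apply: val_inj.
Qed.

Lemma det2E (R : comNzRingType) (A : 'M[R]_2) :
  \det A = A 0 0 * A 1 1 - A 0 1 * A 1 0.
Proof.
rewrite (expand_det_row A 0) !big_ord_recl big_ord0 addr0.
rewrite /cofactor !det_mx11 !mxE /= expr0 expr1 mul1r mulN1r mulrN.
by congr (A _ _ * A _ _ - A _ _ * A _ _); apply: val_inj.
Qed.

(** Cayley-Hamilton in dimension two. *)
Lemma mx2_sqr (R : comNzRingType) (A : 'M[R]_2) :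
  \det A = 1 -> A * A = \tr A *: A - 1.
Proof.
rewrite det2E mxtrace2E => dA.
by apply: matrix2P; rewrite mulmx2E !mxE /= -?dA; ring.
Qed.

Lemma is_scalar_mx2 (R : nzRingType) (A : 'M[R]_2) :
  is_scalar_mx A = [&& A 0 1 == 0, A 1 0 == 0 & A 0 0 == A 1 1].
Proof.
apply/is_scalar_mxP/and3P => [[c ->]|[/eqP A01 /eqP A10 /eqP A00]].
  by rewrite !mxE !eqxx.
by exists (A 0 0); apply: matrix2P; rewrite ?A01 ?A10 -?A00 !mxE.
Qed.

(** Nilpotent matrices orthogonal for the trace form are proportional: the two by two minors of
    their coordinates vanish, in characteristic 2 as well. *)
Lemma nilpotent_mx2_comm (F : fieldType) (A B : 'M[F]_2) :
  \tr A = 0 -> \det A = 0 -> \tr B = 0 -> \det B = 0 -> \tr (A * B) = 0 ->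
  A * B = B * A.
Proof.
rewrite !det2E !mxtrace2E !mulmx2E.
set x := A 0 0; set y := A 0 1; set z := A 1 0.
set x' := B 0 0; set y' := B 0 1; set z' := B 1 0.
move=> /eqP; rewrite addrC addr_eq0 => /eqP eA dA.
move=> /eqP; rewrite addrC addr_eq0 => /eqP eB dB.
rewrite eA eB in dA dB * => tAB.
have sq0 (t : F) : t * t = 0 -> t = 0.
  by move/eqP; rewrite mulf_eq0 orbb => /eqP.
(* The squares of the entries of A * B - B * A lie, up to factors 4, in the
   ideal generated by det A, det B and tr (A * B). *)
set dtA := (X in X = 0) in dA; set dtB := (X in X = 0) in dB.
set t := (X in X = 0) in tAB.
have yz : y * z' = y' * z.
  apply/subr0_eq/sq0; transitivity
    (t * (t - 4 * (x * x')) - 4 * (x ^+ 2 * dtB + dtA * x' ^+ 2 + dtA * dtB)).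
    by rewrite /t /dtA /dtB; ring.
  by rewrite tAB dA dB; ring.
have xy : x * y' = x' * y.
  apply/subr0_eq/sq0.
  transitivity (- (dtA * y' ^+ 2 + dtB * y ^+ 2 + t * (y * y'))).
    by rewrite /t /dtA /dtB; ring.
  by rewrite tAB dA dB; ring.
have xz : x * z' = x' * z.
  apply/subr0_eq/sq0.
  transitivity (- (dtA * z' ^+ 2 + dtB * z ^+ 2 + t * (z * z'))).
    by rewrite /t /dtA /dtB; ring.
  by rewrite tAB dA dB; ring.
apply: matrix2P; rewrite !mulmx2E -/x -/y -/z -/x' -/y' -/z' ?eA ?eB.
- by ring: yz.
- by ring: xy.
- by ring: xz.
- by ring: yz.
Qed.

(** * Powers of a matrix in terms of its eigenvalues *)

Section Powers.
Variables (K : fieldType) (M : 'M[K]_2) (l : K).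
Hypotheses (detM : \det M = 1) (l0 : l != 0) (trM : \tr M = l + l^-1).

(** Cayley-Hamilton factors as [(M - l) (M - l^-1) = 0], so the nonzero columns of each factor are
    eigenvectors for the other eigenvalue. *)
Lemma eigen_mull : M * (M - l^-1%:M) = l *: (M - l^-1%:M).
Proof.
rewrite mulrBr mx2_sqr // trM -mulmxE mul_mx_scalar scalerDl scalerBr.
by rewrite scale_scalar_mx divff // addrAC addrK.
Qed.

Lemma eigen_mulVl : M * (M - l%:M) = l^-1 *: (M - l%:M).
Proof.
rewrite mulrBr mx2_sqr // trM -mulmxE mul_mx_scalar scalerDl scalerBr.
by rewrite scale_scalar_mx mulVf // addrAC [l *: M + _]addrC addrK.
Qed.

(** Decomposition along the two eigenspaces; keeping [l - l^-1] on the left avoids any division. *)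
Lemma mx2_exp_diag k :
  (l - l^-1) *: M ^+ k = l ^+ k *: (M - l^-1%:M) - l^-1 ^+ k *: (M - l%:M).
Proof.
elim: k => [|k IHk].
  rewrite !expr0 !scale1r opprB [X in _ = X]addrC addrA subrK.
  by rewrite scalemx1 raddfB.
rewrite exprS scalerAr IHk mulrBr -!scalerAr eigen_mull eigen_mulVl.
by rewrite !scalerA -!exprSr.
Qed.

(** Here [M - l] has square zero, so the binomial expansion stops at the linear term. At [k = 0] the
    truncated [k.-1] is harmless, its coefficient being 0. *)
Lemma mx2_exp_unip k : l = l^-1 ->
  M ^+ k = l ^+ k *: 1 + (k%:R * l ^+ k.-1) *: (M - l%:M).
Proof.
move=> lV; elim: k => [|k IHk]; first by rewrite mul0r scale0r addr0 scale1r.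
rewrite exprS IHk mulrDr -!scalerAr eigen_mulVl -lV mulr1.
have -> : l ^+ k *: M = l ^+ k.+1 *: 1 + l ^+ k *: (M - l%:M).
  by rewrite exprSr -scalerA scalemx1 -scalerDr addrC subrK.
rewrite -addrA scalerA -scalerDl; congr (_ + _ *: _).
by case: k {IHk} => [|k]; rewrite ?mul0r -?mulrA -?exprSr ?addr0 ?mul1r //
   (mulrSr _ k.+1) mulrDl mul1r addrC.
Qed.

Hypothesis nsM : ~~ is_scalar_mx M.

Lemma subr_scalar_neq0 c : M - c%:M != 0.
Proof.
apply: contraNneq nsM => /eqP; rewrite subr_eq0 => /eqP->.
by apply/is_scalar_mxP; exists c.
Qed.

(** As [M] is not scalar, both eigenvalues have eigenvectors, so a scalar power forces
    [l ^+ k = l^-1 ^+ k]. *)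
Lemma scalar_exp_diag k : l ^+ 2 != 1 ->
  is_scalar_mx (M ^+ k) = ((l ^+ 2) ^+ k == 1).
Proof.
move=> l2; have dl: l - l^-1 != 0.
  apply: contraNneq l2 => /eqP; rewrite subr_eq0 expr2 => /eqP{2}->.
  by rewrite divff.
have <-: (l ^+ k == l^-1 ^+ k) = ((l ^+ 2) ^+ k == 1).
  rewrite exprAC expr2 exprVn -(inj_eq (mulIf (expf_neq0 k l0))).
  by rewrite mulVf ?expf_neq0.
apply/is_scalar_mxP/eqP => [[c Mc]|lk].
  have eqc (d : K) (N : 'M_2) : N != 0 -> M * N = d *: N -> c = d ^+ k.
    move=> N0 MN; have: M ^+ k * N = d ^+ k *: N.
      elim: (k) => [|i IHi]; first by rewrite mul1r scale1r.
      by rewrite exprSr -mulrA MN -scalerAr IHi scalerA -exprS.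
    rewrite Mc -mulmxE mul_scalar_mx => /eqP; rewrite -subr_eq0 -scalerBl.
    by rewrite scaler_eq0 (negPf N0) orbF subr_eq0 => /eqP.
  by rewrite -(eqc _ _ (subr_scalar_neq0 _) eigen_mull)
             -(eqc _ _ (subr_scalar_neq0 _) eigen_mulVl).
exists (l ^+ k); apply: (scalerI dl); rewrite mx2_exp_diag -lk -scalerBr.
rewrite opprB [X in _ *: X]addrC addrA subrK -raddfB /=.
by rewrite !scale_scalar_mx mulrC.
Qed.

Lemma scalar_exp_unip k : l ^+ 2 = 1 ->
  is_scalar_mx (M ^+ k) = (k%:R == 0 :> K).
Proof.
move=> l2; have lV: l = l^-1 by apply: (mulfI l0); rewrite -expr2 l2 divff.
rewrite mx2_exp_unip //; apply/idP/eqP => [/is_scalar_mxP[c Mc]|->]; last first.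
  by rewrite mul0r scale0r addr0 scalemx1; apply/is_scalar_mxP; eexists.
apply/eqP; apply: contraNT nsM => k0.
have d0 : k%:R * l ^+ k.-1 != 0 by rewrite mulf_neq0 ?expf_neq0.
(* The witness solves the expansion of [M ^+ k] for [M], which is possible once [k%:R] is
   invertible. *)
apply/is_scalar_mxP; exists (l + (k%:R * l ^+ k.-1)^-1 * (c - l ^+ k)).
apply: (addIr (- l%:M)); rewrite raddfD /= [X in _ = X - _]addrC addrK.
apply: (scalerI d0); rewrite (canRL (addKr _) Mc) scalemx1.
by rewrite scale_scalar_mx mulrA divff // mul1r raddfB /= addrC.
Qed.

End Powers.

(** * Roots of unity and the count of trace values *)

Lemma prim_root_dvdP (F : fieldType) (z : F) n : (0 < n)%N ->
  (forall m, (z ^+ m == 1) = (n %| m)%N) -> n.-primitive_root z.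
Proof.
move=> n_gt0 zE; rewrite /primitive_root_of_unity n_gt0.
apply/forallP => i; rewrite unity_rootE zE; apply/eqP.
apply/idP/eqP => [/dvdn_leq|->//]; rewrite ltnS => le_ni.
by apply/eqP; rewrite eqn_leq ltn_ord le_ni.
Qed.

Lemma closed_eigen (K : closedFieldType) (t : K) :
  exists2 l, l != 0 & t = l + l^-1.
Proof.
have [|l] := closed_rootP (Poly [:: 1; - t; 1]) _.
  by rewrite (PolyK (c := 0)) //= oner_neq0.
rewrite /root horner_Poly /= mul0r add0r mul1r => /eqP lE.
have l0 : l != 0.
  by apply: contra_eq_neq lE => ->; rewrite mulr0 add0r oner_neq0.
exists l => //; apply: (mulIf l0); rewrite mulrDl mulVf //.
by apply/subr0_eq; rewrite -oppr0 -lE; ring.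
Qed.

Lemma sum_inv_sqr (K : fieldType) (x e : K) : x != 0 -> e ^+ 2 = 1 ->
  x + x^-1 = e *+ 2 -> x = e.
Proof.
move=> x0 e2 xE; apply/eqP; rewrite -subr_eq0 -sqrf_eq0; apply/eqP.
transitivity (x * (x + x^-1 - e *+ 2)); last by rewrite xE subrr mulr0.
rewrite sqrrB e2 mulrBr mulrDr divff // -expr2 addrAC.
by rewrite mulrnAr.
Qed.

(** Meant for [s k = \tr (A ^+ k * B) ^+ 2], [z = l ^+ 2] and [d = (l - l^-1) ^+ 2]. The relation
    [R k j] is counted in two ways. *)
Lemma trace_values_absurd (K : fieldType) n (z d u v : K) (s : nat -> K) :
    n.-primitive_root z -> (2 < n)%N -> d != 0 -> (u != 0) || (v != 0) ->
    (forall k, d * s k * z ^+ k = (u * z ^+ k + v) ^+ 2) ->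
    (forall k, exists2 w, n.-primitive_root w & s k = 2 + (w + w^-1)) ->
  False.
Proof.
move=> prz n2 d0 uv sE sP.
have n0 : (0 < n)%N by apply: ltn_trans n2.
pose R (k j : 'I_n) := s k == 2 + (z ^+ j + (z ^+ j)^-1).
have le2 j : (#|[pred k | R k j]| <= 2)%N.
  pose c := 2 + (z ^+ j + (z ^+ j)^-1).
  (* The coefficients of [(u X + v)^2 - d c X]: each [k] related to [j] makes [z ^+ k] a root. *)
  pose p := Poly [:: v ^+ 2; u * v *+ 2 - d * c; u ^+ 2].
  have p0 : p != 0.
    apply/eqP => /polyP p0; have := p0 0; have := p0 2.
    rewrite !coef_Poly !coef0 /= => /eqP; rewrite sqrf_eq0 => u0 /eqP.
    by rewrite sqrf_eq0 => w0; rewrite u0 w0 in uv.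
  have /(max_poly_roots p0) : all (root p) [seq z ^+ (k : 'I_n) | k in R^~ j].
    apply/allP => _ /mapP[k + ->]; rewrite mem_enum => /eqP Rk.
    rewrite /root horner_Poly /=; apply/eqP.
    have := sE k; rewrite Rk -/c => eqk.
    transitivity ((u * z ^+ k + v) ^+ 2 - d * c * z ^+ k); first by ring.
    by rewrite eqk subrr.
  rewrite map_inj_in_uniq ?enum_uniq => [/(_ isT)|k k' _ _ /eqP]; last first.
    by rewrite (eq_prim_root_expr prz) !modn_small // => /eqP/val_inj.
  rewrite size_map -cardE => /leq_trans/(_ (size_Poly _)).
  by rewrite ltnS.
(* The index 0 gives the root 1: [w + w^-1 = 2] would force [w = 1], which is not primitive. *)
have eq0 : #|[pred k | R k (Ordinal n0)]| = 0%N.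
  apply: eq_card0 => k; rewrite !inE; apply/negP; rewrite /R /= expr0 invr1.
  have [w prw ->] := sP k => /eqP/addrI/sum_inv_sqr w1.
  have := prim_order_dvd prw 1.
  rewrite expr1 w1 ?eqxx ?expr1n // ?dvdn1; last first.
    by rewrite (prim_root_eq0 prw) -lt0n.
  by case: n n2 {prz n0 R le2 k w1 prw sP} => [|[]].
(* Both [w] and [w^-1] occur, and they differ because [w] has order above 2. *)
have ge2 k : (2 <= #|[pred j | R k j]|)%N.
  have [w prw sw] := sP k.
  have [i wi] := prim_rootP prz (prim_expr_order prw).
  have [|i' wi'] := prim_rootP prz (x := w^-1).
    by rewrite exprVn prim_expr_order // invr1.
  have ne : i != i'.
    apply/eqP => ii; have := prim_order_dvd prw 2.
    rewrite {1}expr2 {2}wi ii -wi' divff; last first.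
      by rewrite (prim_root_eq0 prw) -lt0n.
    by rewrite eqxx gtnNdvd.
  have <- : #|[set i; i']| = 2%N by rewrite cards2 ne.
  apply/subset_leq_card/subsetP => j; rewrite !inE /R sw => /orP[]/eqP->.
    by rewrite -wi.
  by rewrite -wi' invrK [w^-1 + w]addrC.
have : (\sum_(k < n) 2 <= \sum_(k < n) \sum_(j < n | R k j) 1)%N.
  by apply: leq_sum => k _; rewrite sum1_card ge2.
rewrite (exchange_big_dep predT) //= [X in (_ <= X)%N](bigD1 (Ordinal n0)) //=.
rewrite sum1_card eq0 add0n leqNgt => /negP; apply.
apply: (@leq_ltn_trans (\sum_(j < n | j != Ordinal n0) 2)).
  by apply: leq_sum => j _; rewrite sum1_card le2.
by rewrite [X in (_ < X)%N](bigD1 (Ordinal n0)).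
Qed.

(** Order of the image in PSL_2, phrased by scalar powers so that it survives the passage to an
    algebraic closure. *)
Definition has_proj_order (F : fieldType) n (M : 'M[F]_2) :=
  \det M = 1 /\ forall m, is_scalar_mx (M ^+ m) = (n %| m)%N.

(** If [l ^+ 2 = 1], then [M ^+ n] being scalar gives [n%:R = 0]; otherwise [l ^+ 2] is a primitive
    root of order [n], which forces [n%:R] to be nonzero. *)
Lemma has_proj_order_eigen (K : closedFieldType) n (M : 'M[K]_2) :
  (2 < n)%N -> has_proj_order n M ->
  [/\ ~~ is_scalar_mx M, \det M = 1 &
  exists l : K, [/\ l != 0, \tr M = l + l^-1 &
    if n%:R == 0 :> K then l ^+ 2 = 1
    else n.-primitive_root (l ^+ 2)]].
Proof.
move=> n_gt2 [dM oM]; have nsM : ~~ is_scalar_mx M.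
  by have := oM 1%N; rewrite expr1 dvdn1 => ->; rewrite gtn_eqF // ltnW.
split=> //; have [l l0 tM] := closed_eigen (\tr M).
exists l; split=> //; have [l2|l2] := eqVneq (l ^+ 2) 1.
  by have := oM n; rewrite dvdnn (scalar_exp_unip dM l0 tM nsM) // => ->.
have prl : n.-primitive_root (l ^+ 2).
  apply: prim_root_dvdP => [|m]; first exact: ltn_trans n_gt2.
  by rewrite -oM (scalar_exp_diag dM l0 tM nsM).
by rewrite (negPf (prim_root_natf_neq0 prl)).
Qed.

Lemma same_proj_order_comm_closed (K : closedFieldType) n (A B : 'M[K]_2) :
  (2 < n)%N -> has_proj_order n A ->
  (forall k, has_proj_order n (A ^+ k * B)) -> A * B = B * A.
Proof.
move=> n_gt2 /[dup] oA /(has_proj_order_eigen n_gt2)[nsA dA [l [l0 tA lP]]] oB.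
have dB : \det B = 1 by have [+ _] := oB 0; rewrite expr0 mul1r.
case: ifP lP => n0 lP.
  (* Characteristic 2 would make [A ^+ 2] scalar, against [n > 2]. *)
  have two0 : 2%:R != 0 :> K.
    by rewrite -(scalar_exp_unip dA l0 tA nsA 2 lP) oA.2 gtnNdvd.
  have tr2 (M : 'M[K]_2) : has_proj_order n M ->
      exists2 e : K, e ^+ 2 = 1 & \tr M = e *+ 2.
    move=> /(has_proj_order_eigen n_gt2)[_ _ [e [e0 tM]]]; rewrite n0 => e2.
    exists e => //; rewrite tM mulr2n; congr (_ + _).
    by apply: (mulfI e0); rewrite divff // -expr2 e2.
  have [e e2 tAe] := tr2 _ oA.
  have [f f2 tBf] := tr2 _ (oB 0); rewrite expr0 mul1r in tBf.
  have [g g2 tAB] := tr2 _ (oB 1); rewrite expr1 in tAB.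
  have [h h2 tAAB] := tr2 _ (oB 2).
  (* Trace of [A ^+ 2 * B = \tr A *: (A * B) - B], halved. *)
  have hE : h = e * g *+ 2 - f.
    apply: (mulfI two0); transitivity (\tr (A ^+ 2 * B)).
      by rewrite tAAB; ring.
    rewrite expr2 mx2_sqr // mulrBl mul1r -scalerAl.
    by rewrite raddfB /= linearZ /= tAB tBf tAe; ring.
  have gE : g = e * f.
    have : (2 * 2) * (e ^+ 2 * g ^+ 2 - e * g * f) = h ^+ 2 - f ^+ 2.
      by rewrite hE; ring.
    rewrite h2 f2 e2 g2 subrr mulr1 => /eqP; rewrite !mulf_eq0 !(negPf two0) /=.
    rewrite subr_eq0 => /eqP egf.
    transitivity (e ^+ 2 * f ^+ 2 * g); first by rewrite e2 f2 !mul1r.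
    by transitivity (e * f * (e * g * f)); [ring | rewrite -egf mulr1].
  (* [A - e] and [B - f] are nilpotent, and [g = e * f] makes the trace of their product vanish. *)
  have comm_scalar (M : 'M[K]_2) c : GRing.comm M c%:M by apply: scalar_mxC.
  rewrite -[A](subrK e%:M) -[B](subrK f%:M).
  apply/commrD/comm_scalar/commr_sym/commrD; last exact: comm_scalar.
  rewrite det2E in dA; rewrite det2E in dB; rewrite mxtrace2E in tAe.
  rewrite mxtrace2E in tBf; rewrite mxtrace2E !mulmx2E gE in tAB.
  apply/commr_sym/nilpotent_mx2_comm;
    rewrite ?det2E ?mxtrace2E ?mulmx2E !mxE /=.
  - by rewrite !mulr1n addrACA tAe; ring.
  - transitivity (1 - e * (e *+ 2) + e ^+ 2); last by ring: e2.
    by rewrite -dA -tAe; ring.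
  - by rewrite !mulr1n addrACA tBf; ring.
  - transitivity (1 - f * (f *+ 2) + f ^+ 2); last by ring: f2.
    by rewrite -dB -tBf; ring.
  - transitivity (e * f *+ 2 - e * (f *+ 2) - f * (e *+ 2) + e * f *+ 2).
      by rewrite -{1}tAB -tAe -tBf; ring.
    by ring.
have l2 : l ^+ 2 != 1.
  have := prim_order_dvd lP 1; rewrite expr1 dvdn1 => <-.
  by rewrite gtn_eqF // ltnW.
pose d := l - l^-1.
have d0 : d != 0.
  apply: contraNneq l2 => /eqP; rewrite subr_eq0 expr2 => /eqP{2}->.
  by rewrite divff.
have trP (M : 'M[K]_2) : has_proj_order n M ->
    exists2 w, n.-primitive_root w & \tr M ^+ 2 = 2 + (w + w^-1).
  move=> /(has_proj_order_eigen n_gt2)[_ _ [e [e0 ->]]]; rewrite n0 => pre.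
  by exists (e ^+ 2) => //; field.
pose u := \tr ((A - l^-1%:M) * B); pose v := - \tr ((A - l%:M) * B).
have trE k : d * \tr (A ^+ k * B) = l ^+ k * u + l^-1 ^+ k * v.
  rewrite -mxtraceZ scalerAl mx2_exp_diag // mulrBl -!scalerAl.
  by rewrite raddfB /= !linearZ /= mulrN.
exfalso.
apply: (@trace_values_absurd _ n (l ^+ 2) (d ^+ 2) u v
  (fun k => \tr (A ^+ k * B) ^+ 2)) => // [||k|k].
- by rewrite sqrf_eq0.
(* If [u = v = 0], then [\tr B = 0], so [w + w^-1 = -2] and [w = -1], of order at most 2. *)
- rewrite -negb_and; apply/negP => /andP[/eqP u0 /eqP v0].
  have tB : \tr B = 0.
    apply: (mulfI d0); have := trE 0; rewrite u0 v0 expr0 mul1r => ->.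
    by rewrite !mulr0 addr0.
  have [w prw] := trP _ (oB 0); rewrite expr0 mul1r tB expr0n /= => wE.
  have w1 : w = -1.
    apply: sum_inv_sqr; rewrite ?sqrr_sign ?sqrrN ?expr1n //.
      by rewrite (prim_root_eq0 prw) -lt0n; apply: ltn_trans n_gt2.
    by apply: (addrI 2); rewrite -wE; ring.
  have := prim_order_dvd prw 2.
  by rewrite w1 sqrrN expr1n eqxx gtnNdvd.
- rewrite -exprMn trE exprAC exprVn; set x := l ^+ k.
  have x0 : x != 0 by rewrite expf_neq0.
  by field.
- exact: trP (oB k).
Qed.

Lemma same_proj_order_comm (F : countFieldType) n (A B : 'M[F]_2) :
  (2 < n)%N -> has_proj_order n A ->
  (forall k, has_proj_order n (A ^+ k * B)) -> A * B = B * A.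
Proof.
move=> n_gt2 oA oB; have [K [h _]] := countable_algebraic_closure F.
have map_order M : has_proj_order n M -> has_proj_order n (map_mx h M).
  case=> dM oM; split=> [|m]; first by rewrite det_map_mx dM rmorph1.
  by rewrite -rmorphXn map_mx_is_scalar.
apply: (map_mx_inj (f := h)); rewrite !rmorphM /=.
apply: (same_proj_order_comm_closed n_gt2 (map_order _ oA)) => k.
by rewrite -rmorphXn -rmorphM; apply: map_order.
Qed.

End TwoByTwo.

(** * Characteristic quotients *)

Section Multiplicative.
Import GroupScope.
Variables (G H : groupType) (f : {multiplicative G -> H}).

Lemma gmorph1 : f 1 = 1.
Proof. by apply: (mulgI (f 1)); rewrite -gmulfM !mulg1. Qed.

Lemma gmorphV x : f x^-1 = (f x)^-1.
Proof. by apply: (mulgI (f x)); rewrite -gmulfM !mulgV gmorph1. Qed.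

Lemma gmorphX n x : f (x ^+ n) = f x ^+ n.
Proof.
by elim: n => [|n IHn]; rewrite ?expg0 ?gmorph1 // !expgS gmulfM IHn.
Qed.

Lemma gmorph_eq x y : f x = f y <-> f (x * y^-1) = 1.
Proof.
have fE : f x = f (x * y^-1) * f y by rewrite -gmulfM mulgKV.
split=> fxy; last by rewrite fE fxy mul1g.
by apply: (mulIg (f y)); rewrite -fE mul1g.
Qed.

Lemma gker_group_closed : group_closed [pred x | f x == 1].
Proof.
split=> [|x y]; rewrite !inE ?gmorph1 // => /eqP fx /eqP fy.
by apply/eqP/gmorph_eq; rewrite fx fy.
Qed.

End Multiplicative.

Section FreeGroupMaps.
Import GroupScope.
Variable X : choiceType.

Lemma fg_lift_commute (G : groupType) (f : X -> G) c :
  (forall i, commute c (f i)) -> forall x, commute c (fg_lift f x).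
Proof.
move=> cf [w rw]; rewrite /fg_lift /=; elim: w {rw} => [|a w IHw] /=.
  exact: commute1.
by apply: commuteM IHw; rewrite /leval; case: ifP => _; last apply: commuteV.
Qed.

Lemma fg_hom_eq (G : groupType) (f g : {multiplicative free_group X -> G}) :
  (forall i, f (fg_gen i) = g (fg_gen i)) -> f =1 g.
Proof.
move=> fg x; rewrite (fg_lift_unique f) (fg_lift_unique g) /fg_lift.
elim: (fg_word x) => //= a w ->; congr (_ * _).
by rewrite /leval /= fg.
Qed.

Lemma fg_lift_can (f g : X -> free_group X) :
  (forall i, fg_lift g (f i) = fg_gen i) -> cancel (fg_lift f) (fg_lift g).
Proof.
move=> gf; apply: (fg_hom_eq (f := fg_lift g \o fg_lift f) (g := idfun)) => i.
by rewrite /= fg_lift_gen.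
Qed.

End FreeGroupMaps.

Section CharQuotient.
Import GroupScope.

(** The definition asks for one inclusion only; the inverse automorphism gives the other. *)
Lemma char_subgroup_aut (G : groupType) (K : {pred G})
    (phi : {multiplicative G -> G}) :
  char_subgroup K -> bijective phi -> forall x, (phi x \in K) = (x \in K).
Proof.
case=> _ charK [psi phiK psiK] x.
pose psiM : {multiplicative G -> G} :=
  HB.pack psi (isMultiplicative.Build _ _ psi (can2_gmulfM phiK psiK)).
apply/idP/idP => [Kx|]; last by apply: charK; exists psi.
by rewrite -(phiK x); apply: (charK psiM) => //; exists phi.
Qed.

(* The centre of the quotient pulls back to the elements commuting with
   everything modulo the kernel, a condition preserved by automorphisms. *)
Lemma char_center (G H : groupType) (f : {multiplicative G -> H})
    (phi : {multiplicative G -> G}) x :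
  (forall h, exists g, f g = h) -> char_subgroup [pred g | f g == 1] ->
  bijective phi -> (forall h, commute (f x) h) ->
  forall h, commute (f (phi x)) h.
Proof.
move=> surj charK phi_bij cx h; have [y <-] := surj h.
have [psi _ psiK] := phi_bij; rewrite -(psiK y); set z := psi y.
rewrite /commute -!gmulfM; apply/gmorph_eq.
have := char_subgroup_aut charK phi_bij (x * z * (z * x)^-1).
rewrite !inE; have -> : f (x * z * (z * x)^-1) == 1.
  by apply/eqP/gmorph_eq; rewrite !gmulfM; apply: cx.
move=> /eqP <-; congr (f _); apply/esym/(mulIg (phi (z * x))).
by rewrite -gmulfM !mulgKV.
Qed.

Variables (gT : finGroupType) (S : {group gT}).

Definition mod_center (x : [subg S]) : [subg S / 'Z(S)] :=
  subg _ (coset 'Z(S) (sgval x)).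

Lemma sgval_mod_center x : sgval (mod_center x) = coset 'Z(S) (sgval x).
Proof. by rewrite subgK // mem_quotient ?subgP. Qed.

Lemma mem_norm_center x : x \in S -> x \in 'N('Z(S)).
Proof. exact/subsetP/gFnorm. Qed.

Lemma mod_centerM : {morph mod_center : x y / x * y}.
Proof.
move=> x y; apply: subg_inj.
rewrite [RHS]sgvalM ?inE // !sgval_mod_center [sgval (x * y)]sgvalM ?inE //.
by rewrite morphM ?mem_norm_center ?subgP.
Qed.

HB.instance Definition _ := isMultiplicative.Build _ _ mod_center mod_centerM.

Lemma mod_center_surj y : exists x, mod_center x = y.
Proof.
have /morphimP[x _ Sx yE] := subgP y.
exists (subg S x); apply: subg_inj.
by rewrite sgval_mod_center subgK.
Qed.

Lemma mod_center_eq1 x : mod_center x = 1 <-> sgval x \in 'Z(S).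
Proof.
split=> [x1|Zx]; last by apply: subg_inj; rewrite sgval_mod_center coset_id.
apply: coset_idr; first by rewrite mem_norm_center ?subgP.
by rewrite -sgval_mod_center x1.
Qed.

Lemma mem_center_subg (x : [subg S]) :
  sgval x \in 'Z(S) <-> forall y, commute x y.
Proof.
split=> [/centerP[_ cx] y|cx].
  by apply: subg_inj; apply: cx; apply: subgP.
apply/centerP; split=> [|y Sy]; first exact: subgP.
have := congr1 sgval (cx (subg S y)).
by rewrite ![sgval (_ * _)]sgvalM ?inE // !subgK.
Qed.

(** The new kernel is the preimage of the centre, which [char_center] shows to be characteristic. *)
Lemma char_quotient_mod_center :
  char_quotient_F2 [subg S]%type -> char_quotient_F2 [subg S / 'Z(S)]%type.
Proof.
case=> f [surj charK]; exists (mod_center \o f); split=> [y|].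
  by have [x <-] := mod_center_surj y; have [g <-] := surj x; exists g.
split; first exact: (gker_group_closed (mod_center \o f)).
move=> phi phi_bij x; rewrite !inE /= => /eqP/mod_center_eq1/mem_center_subg cx.
by apply/eqP/mod_center_eq1/mem_center_subg/char_center.
Qed.

End CharQuotient.

(** * Automorphisms of the free group of rank two *)

Section RankTwo.
Import GroupScope.

(* An unqualified F2 denotes a constant exported by all_solvable. *)
Definition F2a : Defs.F2 := fg_gen ord0.
Definition F2b : Defs.F2 := fg_gen ord_max.

Definition F2_pair (u v : Defs.F2) (i : 'I_2) : Defs.F2 :=
  if i == ord0 then u else v.

Lemma ord2_cases (P : 'I_2 -> Prop) : P ord0 -> P ord_max -> forall i, P i.
Proof.
move=> P0 P1 [[|[]]] // lt_i.
  by have -> : Ordinal lt_i = ord0 by apply: val_inj.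
by have -> : Ordinal lt_i = ord_max by apply: val_inj.
Qed.

(** The map a -> a^k b, b -> a has inverse a -> b, b -> b^-k a. *)
Lemma F2_aut_bij k : bijective (fg_lift (F2_pair (F2a ^+ k * F2b) F2a)).
Proof.
exists (fg_lift (F2_pair F2b (F2b ^- k * F2a))); apply: fg_lift_can;
  apply: ord2_cases;
  by rewrite /F2_pair /F2a /F2b /= ?fg_liftM ?gmorphV ?gmorphX
             ?fg_lift_gen /= ?fg_lift_gen ?(mulKVg, mulKg).
Qed.

Variables (G : groupType) (f : {multiplicative Defs.F2 -> G}).

Lemma char_kernel_orders k m : char_subgroup [pred x | f x == 1] ->
  ((f F2a ^+ k * f F2b) ^+ m == 1) = (f F2a ^+ m == 1).
Proof.
move=> charK; have := char_subgroup_aut charK (F2_aut_bij k) (F2a ^+ m).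
rewrite !inE !gmorphX /= [fg_lift _ _]fg_lift_gen /F2_pair eqxx.
by rewrite gmulfM gmorphX.
Qed.

Lemma F2_quotient_abelian : (forall g, exists x, f x = g) ->
  commute (f F2a) (f F2b) -> forall g h : G, commute g h.
Proof.
move=> surj cab g h; have [x <-] := surj g; have [y <-] := surj h.
rewrite (fg_lift_unique f); apply/commute_sym; rewrite (fg_lift_unique f).
apply: fg_lift_commute => i; apply/commute_sym; apply: fg_lift_commute => j.
by move: i j; do 2!apply: ord2_cases; rewrite /= ?commute_refl.
Qed.

End RankTwo.

(** * Centre and noncommutativity of the linear groups *)

Section SL2Facts.
Import GRing.Theory.
Local Open Scope ring_scope.
Variable F : finFieldType.

Definition SL2_mx (u : [subg SL2 F]) : 'M[F]_2 := GLval (sgval u).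

Lemma SL2_mxM u v : SL2_mx (u * v)%g = SL2_mx u * SL2_mx v.
Proof. by []. Qed.

Lemma SL2_mxX u m : SL2_mx (u ^+ m)%g = SL2_mx u ^+ m.
Proof. by elim: m => [|m IHm] //; rewrite expgS exprS SL2_mxM IHm. Qed.

Lemma SL2_mx_inj : injective SL2_mx.
Proof. by move=> u v uv; apply/subg_inj/val_inj. Qed.

Lemma det_SL2_mx u : \det (SL2_mx u) = 1.
Proof. by have := subgP u; rewrite inE => /eqP. Qed.

Lemma SL2_mx_surj (M : 'M[F]_2) : \det M = 1 -> exists u, SL2_mx u = M.
Proof.
move=> dM; have uM : M \is a GRing.unit by rewrite unitmxE dM unitr1.
exists (subg _ (FinRing.Unit uM)); rewrite /SL2_mx subgK // inE.
exact/eqP.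
Qed.

(** Two transvections suffice: only scalars commute with both, and they do not commute even up to a
    scalar. *)
Let E01 : 'M[F]_2 := 1 + delta_mx 0 1.
Let E10 : 'M[F]_2 := 1 + delta_mx 1 0.

Let det_E01 : \det E01 = 1.
Proof. by rewrite det2E !mxE /= !addr0 mulr0 subr0 mulr1. Qed.

Let det_E10 : \det E10 = 1.
Proof. by rewrite det2E !mxE /= !addr0 mul0r subr0 mulr1. Qed.

Lemma mod_center_SL2_eq1 u :
  (mod_center u == 1%g) = is_scalar_mx (SL2_mx u).
Proof.
apply/eqP/idP => [/mod_center_eq1/mem_center_subg cu|/is_scalar_mxP[c uc]].
  have comm_u (M : 'M[F]_2) : \det M = 1 -> SL2_mx u * M = M * SL2_mx u.
    by case/SL2_mx_surj => v <-; rewrite -!SL2_mxM cu.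
  have /matrixP c01 := comm_u _ det_E01.
  have /matrixP c10 := comm_u _ det_E10.
  move: (c01 0 0) (c01 0 1) (c10 0 0); rewrite !mulmx2E !mxE /=.
  rewrite !(mulr0n, mulr1n, addr0, add0r, mulr0, mulr1, mul0r, mul1r).
  rewrite -{1}[SL2_mx u 0 0]addr0 => /addrI u10; rewrite addrC => /addrI u00.
  rewrite -{2}[SL2_mx u 0 0]add0r => /addIr u01.
  by rewrite is_scalar_mx2 u01 -u10 u00 !eqxx.
apply/mod_center_eq1/mem_center_subg => v; apply: SL2_mx_inj.
by rewrite !SL2_mxM uc -mulmxE scalar_mxC.
Qed.

Lemma PSL2_nonabelian : ~ forall x y : [subg PSL2 F], commute x y.
Proof.
move=> ab; have [u uE] := SL2_mx_surj det_E01.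
have [v vE] := SL2_mx_surj det_E10.
have /gmorph_eq/eqP : mod_center (u * v)%g = mod_center (v * u)%g.
  by rewrite !gmulfM; apply: ab.
rewrite mod_center_SL2_eq1 => /is_scalar_mxP[c wc].
have : SL2_mx (u * v)%g = c *: SL2_mx (v * u)%g.
  by rewrite -mul_scalar_mx -wc mulmxE -SL2_mxM mulgKV.
rewrite !SL2_mxM uE vE => eE.
have eij i j : (E01 * E10) i j = c * (E10 * E01) i j by rewrite eE mxE.
(* Entry (0, 1) gives [c = 1], and then entry (1, 1) reads [1 = 1 + 1]. *)
move: (eij 0 1) (eij 1 1); rewrite !mulmx2E !mxE /=.
rewrite !(mulr0n, mulr1n, addr0, add0r, mulr0, mulr1, mul0r).
move=> <-; rewrite mul1r -{1}[1]addr0 => /addrI/eqP.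
by rewrite eq_sym oner_eq0.
Qed.

End SL2Facts.

Section PSL2Quotient.
Variable F : finFieldType.
Import GroupScope.

Lemma PSL2_not_char_quotient : ~ char_quotient_F2 [subg PSL2 F]%type.
Proof.
case=> f [surj charK]; apply: (@PSL2_nonabelian F).
apply: F2_quotient_abelian surj _.
have ords k m := char_kernel_orders k m charK.
set x := f F2a in ords *; set y := f F2b in ords *.
have [n_le2|n_gt2] := leqP #[x] 2.
  have x2 : x ^+ 2 == 1.
    by rewrite -order_dvdn; have := order_gt0 x; case: #[x] n_le2 => [|[|[]]].
  have invE (z : [subg PSL2 F]) : z ^+ 2 == 1 -> z^-1 = z.
    by move/eqP=> z2; apply: (mulIg z); rewrite mulVg; exact: esym z2.
  have := ords 0 2; have := ords 1%N 2; rewrite x2 mul1g expg1.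
  move=> /invE xyV /invE yV; rewrite /commute -xyV invMg yV.
  by congr (_ * _); apply: invE.
have [u ux] := mod_center_surj x.
have [v vy] := mod_center_surj y.
(* The order of [x] modulo the centre becomes a projective order of matrices, shared by lifts of [x]
   and of every [x ^+ k * y]. *)
have proj_order w : (forall m, (mod_center w ^+ m == 1) = (x ^+ m == 1)) ->
    has_proj_order #[x] (SL2_mx w).
  move=> wE; split=> [|m]; first exact: det_SL2_mx.
  by rewrite order_dvdn -wE -gmorphX mod_center_SL2_eq1 SL2_mxX.
rewrite -ux -vy; apply/gmulf_commute/SL2_mx_inj; rewrite !SL2_mxM.
apply: (same_proj_order_comm n_gt2) => [|k].
  by apply: proj_order => m; rewrite ux.
rewrite -SL2_mxX -SL2_mxM; apply: proj_order => m.
by rewrite gmulfM gmorphX /= ux vy ords.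
Qed.

End PSL2Quotient.

Theorem corollary5p4 (q : nat)
    (hq : exists p k : nat, [/\ prime p, (0 < k)%N & q = (p ^ k)%N])
    (F : finFieldType) (hF : #|F| = q) :
  ~ char_quotient_F2 [subg SL2 F] /\ ~ char_quotient_F2 [subg PSL2 F].
Proof.
split=> [/char_quotient_mod_center|]; exact: PSL2_not_char_quotient.
Qed.
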